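(* (Translation covariance.) Let $n\equiv 2$ or $3\pmod 4$, let $\psi\in L^2(\mathbb{R}^n;Cl_n)$ be an admissible Clifford mother wavelet, let $f\in L^2(\mathbb{R}^n;Cl_n)$ and $x_0\in\mathbb{R}^n$. Then for all $a>0$, $r_\theta\in SO(n)$, $b\in\mathbb{R}^n$, $$[T_\psi f(\cdot-x_0)](a,\theta,b)=T_\psi f(a,\theta,b-x_0) ,$$ where the left side is the Clifford wavelet transform of the function $x\mapsto f(x-x_0)$.
   Context: $Cl_n=Cl_{n,0}$ is the real Clifford algebra of Euclidean $\mathbb{R}^n$ with orthonormal vectors $e_1,\dots,e_n$ and basis blades $e_A$; $M=\sum_AM_Ae_A$, $|M|^2=\sum_AM_A^2$. The reverse is $\widetilde M=\sum_k(-1)^{k(k-1)/2}\langle M\rangle_k$ (also written $\{M\}^\sim$), $\langle M\rangle_k$ being the grade-$k$ part. $L^2(\mathbb{R}^n;Cl_n)$ is the space of $f:\mathbb{R}^n\to Cl_n$ with $\int|f|^2<\infty$. $i_n=e_1\cdots e_n$, $i_n^2=-1$ for $n\equiv 2,3\pmod 4$. Clifford Fourier transform: $\widehat f(\omega)=\int_{\mathbb{R}^n}f(x)e^{-i_n\omega\cdot x}d^nx$ (extended to $L^2$). Daughter wavelets, for $a>0$, $r_\theta\in SO(n)$ (parametrized by $\theta$), $b\in\mathbb{R}^n$: $\psi_{a,\theta,b}(x)=a^{-n/2}\psi\bigl(r_\theta^{-1}((x-b)/a)\bigr)$. Admissibility: $\psi\in L^2(\mathbb{R}^n;Cl_n)$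 is admissible if $C_\psi=\int_{\mathbb{R}^+}\int_{SO(n)}a^n\{\widehat\psi(a r_\theta^{-1}(\omega))\}^{\sim}\,\widehat\psi(a r_\theta^{-1}(\omega))\,a^{-(n+1)}da\,d\theta$ ($d\theta$ the normalized Haar measure on $SO(n)$) is, for a.e. $\omega$, a finite invertible multivector constant. In addition, for $n\equiv2\pmod4$, $\psi$ is required to have only even-grade or only odd-grade values. Clifford wavelet transform: $T_\psi f(a,\theta,b)=\int_{\mathbb{R}^n}f(x)\widetilde{\psi_{a,\theta,b}(x)}\,d^nx$. *)

(* Defs.v *)
From HB Require Import structures.
From mathcomp Require Import all_boot all_order all_algebra.
From mathcomp Require Import all_classical all_reals all_analysis.

Set Implicit Arguments.
Unset Strict Implicit.
Unset Printing Implicit Defensive.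

Import Order.TTheory GRing.Theory Num.Theory.
Import numFieldNormedType.Exports.

Local Open Scope classical_set_scope.
Local Open Scope ring_scope.

(* M : Cl R n is the family of its blade coefficients M_A, A : {set 'I_n}. *)
Definition Cl (R : realType) (n : nat) : Type := {ffun {set 'I_n} -> R}.

HB.instance Definition _ (R : realType) (n : nat) :=
  GRing.Lmodule.copy (Cl R n) {ffun {set 'I_n} -> R}.

Section Clifford.
Variables (R : realType) (n : nat).
Implicit Types (A B C : {set 'I_n}) (M N P : Cl R n).

Definition blade A : Cl R n := [ffun B => (B == A)%:R].

Definition symdiff A B : {set 'I_n} := (A :\: B) :|: (B :\: A).

Definition inversions A B : nat :=
  #|[set p : 'I_n * 'I_n | [&& p.1 \in A, p.2 \in B & (p.2 < p.1)%N]]%SET|.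

(* Sorting the word e_A e_B takes one transposition e_i e_j = - e_j e_i per
   inversion; then e_i e_i = 1 cancels the common vectors. *)
Definition blade_sign A B : R := (-1) ^+ inversions A B.

Definition cl_mul M N : Cl R n :=
  \sum_A \sum_B (M A * N B * blade_sign A B) *: blade (symdiff A B).

Lemma cl_addE M N A : (M + N) A = M A + N A.
Proof. by rewrite ffunE. Qed.

Lemma cl_scaleE c M A : (c *: M) A = c * M A.
Proof. by rewrite ffunE. Qed.

Lemma cl_blade_decomp M : M = \sum_A M A *: blade A.
Proof.
apply/ffunP => B; rewrite sum_ffunE (bigD1 B) //= big1 => [|A AB].
  by rewrite addr0 cl_scaleE ffunE eqxx mulr1.
by rewrite cl_scaleE ffunE eq_sym (negbTE AB) mulr0.
Qed.

Lemma cl_mulDl : left_distributive cl_mul +%R.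
Proof.
move=> M N P; rewrite /cl_mul -big_split; apply: eq_bigr => A _ /=.
rewrite -big_split; apply: eq_bigr => B _ /=.
by rewrite cl_addE !mulrDl scalerDl.
Qed.

Lemma cl_mulDr : right_distributive cl_mul +%R.
Proof.
move=> M N P; rewrite /cl_mul -big_split; apply: eq_bigr => A _ /=.
rewrite -big_split; apply: eq_bigr => B _ /=.
by rewrite cl_addE mulrDr !mulrDl scalerDl.
Qed.

Lemma cl_mulZl c M N : cl_mul (c *: M) N = c *: cl_mul M N.
Proof.
rewrite /cl_mul scaler_sumr; apply: eq_bigr => A _.
rewrite scaler_sumr; apply: eq_bigr => B _.
by rewrite cl_scaleE scalerA !mulrA.
Qed.

Lemma cl_mulZr c M N : cl_mul M (c *: N) = c *: cl_mul M N.
Proof.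
rewrite /cl_mul scaler_sumr; apply: eq_bigr => A _.
rewrite scaler_sumr; apply: eq_bigr => B _.
by rewrite cl_scaleE scalerA mulrCA !mulrA.
Qed.

Lemma cl_mul_suml (I : Type) (r : seq I) (Q : pred I) (F : I -> Cl R n) N :
  cl_mul (\sum_(i <- r | Q i) F i) N = \sum_(i <- r | Q i) cl_mul (F i) N.
Proof.
elim/big_rec2: _ => [|i M P _ <-]; last by rewrite cl_mulDl.
by have := cl_mulZl 0 0 N; rewrite !scale0r.
Qed.

Lemma cl_mul_sumr (I : Type) (r : seq I) (Q : pred I) (F : I -> Cl R n) N :
  cl_mul N (\sum_(i <- r | Q i) F i) = \sum_(i <- r | Q i) cl_mul N (F i).
Proof.
elim/big_rec2: _ => [|i M P _ <-]; last by rewrite cl_mulDr.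
by have := cl_mulZr 0 N 0; rewrite !scale0r.
Qed.

Lemma cl_mul_blade A B :
  cl_mul (blade A) (blade B) = blade_sign A B *: blade (symdiff A B).
Proof.
rewrite /cl_mul (bigD1 A) //= (bigD1 B) //= !ffunE !eqxx !mul1r.
rewrite !big1 ?addr0 // => [C CA|C CB].
  by rewrite big1 // => D _; rewrite !ffunE (negbTE CA) !mul0r scale0r.
by rewrite !ffunE (negbTE CB) mulr0 mul0r scale0r.
Qed.

Lemma in_symdiff A B i : (i \in symdiff A B) = (i \in A) (+) (i \in B).
Proof. by rewrite !inE; case: (i \in A); case: (i \in B). Qed.

Lemma symdiffA : associative symdiff.
Proof. by move=> A B C; apply/setP => i; rewrite !in_symdiff addbA. Qed.

Lemma blade_signE A B : blade_sign A B =
  \prod_(p : 'I_n * 'I_n) (-1) ^+ [&& p.1 \in A, p.2 \in B & (p.2 < p.1)%N].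
Proof.
rewrite /blade_sign /inversions -prodr_const big_mkcond /=.
by apply: eq_bigr => p _; rewrite inE; case: ifP.
Qed.

Lemma blade_sign_symdiffl A B C :
  blade_sign (symdiff A B) C = blade_sign A C * blade_sign B C.
Proof.
rewrite !blade_signE -big_split; apply: eq_bigr => p _ /=.
rewrite -signr_addb in_symdiff.
by case: (p.1 \in A); case: (p.1 \in B) => /=; rewrite ?addbF ?addbb.
Qed.

Lemma blade_sign_symdiffr A B C :
  blade_sign A (symdiff B C) = blade_sign A B * blade_sign A C.
Proof.
rewrite !blade_signE -big_split; apply: eq_bigr => p _ /=.
rewrite -signr_addb in_symdiff.
by case: (p.1 \in A); case: (p.2 \in B); case: (p.2 \in C) => /=;
  rewrite ?addbF ?addbb.
Qed.

Lemma blade_mulA A B C :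
  cl_mul (blade A) (cl_mul (blade B) (blade C)) =
  cl_mul (cl_mul (blade A) (blade B)) (blade C).
Proof.
rewrite !cl_mul_blade cl_mulZr cl_mulZl !cl_mul_blade.
rewrite symdiffA blade_sign_symdiffl blade_sign_symdiffr !scalerA.
by rewrite [X in X *: _]mulrC -mulrA.
Qed.

Lemma cl_mulA : associative cl_mul.
Proof.
have := (cl_mul_suml, cl_mul_sumr, cl_mulZl, cl_mulZr, blade_mulA).
move: cl_mul => mul [[[[suml sumr] Zl] Zr] mA] M N P.
rewrite (cl_blade_decomp M) (cl_blade_decomp N) (cl_blade_decomp P).
rewrite !suml; apply: eq_bigr => A _.
rewrite sumr (sumr _ _ _ _ (M A *: blade A)) suml; apply: eq_bigr => B _.
rewrite !sumr; apply: eq_bigr => C _.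
by rewrite !(Zl, Zr) mA !scalerA mulrC mulrA.
Qed.

Lemma symdiff0l A : symdiff finset.set0 A = A.
Proof. by apply/setP => i; rewrite in_symdiff inE. Qed.

Lemma symdiff0r A : symdiff A finset.set0 = A.
Proof. by apply/setP => i; rewrite in_symdiff inE addbF. Qed.

Lemma cl_mul1l : left_id (blade finset.set0) cl_mul.
Proof.
move=> M; rewrite {1}(cl_blade_decomp M) cl_mul_sumr.
rewrite [RHS]cl_blade_decomp; apply: eq_bigr => A _.
rewrite cl_mulZr cl_mul_blade symdiff0l blade_signE big1 ?scale1r // => p _.
by rewrite inE.
Qed.

Lemma cl_mul1r : right_id (blade finset.set0) cl_mul.
Proof.
move=> M; rewrite {1}(cl_blade_decomp M) cl_mul_suml.
rewrite [RHS]cl_blade_decomp; apply: eq_bigr => A _.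
rewrite cl_mulZl cl_mul_blade symdiff0r blade_signE big1 ?scale1r // => p _.
by rewrite !inE andbF.
Qed.

Lemma cl_oner_neq0 : blade finset.set0 != 0 :> Cl R n.
Proof.
by apply/eqP => /ffunP/(_ finset.set0)/eqP; rewrite !ffunE eqxx oner_eq0.
Qed.

HB.instance Definition _ := GRing.Zmodule_isNzRing.Build (Cl R n)
  cl_mulA cl_mul1l cl_mul1r cl_mulDl cl_mulDr cl_oner_neq0.

Lemma cl_scalerAl c M N : c *: (M * N) = (c *: M) * N.
Proof. by rewrite [RHS]cl_mulZl. Qed.

Lemma cl_scalerAr c M N : c *: (M * N) = M * (c *: N).
Proof. by rewrite [RHS]cl_mulZr. Qed.

HB.instance Definition _ :=
  GRing.Lmodule_isLalgebra.Build R (Cl R n) cl_scalerAl.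
HB.instance Definition _ :=
  GRing.Lalgebra_isAlgebra.Build R (Cl R n) cl_scalerAr.

Definition cl_e (i : 'I_n) : Cl R n := blade [set i]%SET.

Definition pseudoscalar : Cl R n := \prod_(i < n) cl_e i.

Definition cl_norm M : R := Num.sqrt (\sum_A M A ^+ 2).

Definition grade (k : nat) M : Cl R n :=
  [ffun A : {set 'I_n} => if #|A| == k then M A else 0].

Definition reverse M : Cl R n :=
  \sum_(k < n.+1) (-1) ^+ ((k * k.-1)./2) *: grade k M.

Definition even_grade M := forall A, odd #|A| -> M A = 0.
Definition odd_grade M := forall A, ~~ odd #|A| -> M A = 0.

Definition cl_invertible M := exists N, M * N = 1 /\ N * M = 1.

Definition cl_exp M : Cl R n :=
  [ffun A => limn (series (fun k => (k`!%:R^-1 *: M ^+ k) A))].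

End Clifford.

Lemma cl_e_sqr (R : realType) n (i : 'I_n) : cl_e R i * cl_e R i = 1.
Proof.
rewrite [LHS]cl_mul_blade blade_signE big1 => [|[j k] _].
  rewrite scale1r; congr blade; apply/setP => j.
  by rewrite in_symdiff !inE addbb.
by rewrite !inE /=; case: eqP => // ->; case: eqP => // ->; rewrite ltnn.
Qed.

Lemma cl_e_anticomm (R : realType) n (i j : 'I_n) : i != j ->
  cl_e R i * cl_e R j = - (cl_e R j * cl_e R i).
Proof.
wlog ij : i j / (i < j)%N.
  move=> H ij; have := ij; rewrite -val_eqE neq_ltn => /orP[|ji].
    by move/H; apply.
  by rewrite (H j i ji) ?opprK // eq_sym.
move=> _.
rewrite [LHS]cl_mul_blade [X in - X]cl_mul_blade -scaleNr.
have -> : symdiff [set j]%SET [set i]%SET = symdiff [set i]%SET [set j]%SET.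
  by apply/setP => k; rewrite !in_symdiff addbC.
congr (_ *: _); rewrite !blade_signE (bigD1 (j, i)) //= big1 => [|p pij].
  rewrite (bigD1 (j, i)) //= big1 => [|p pij].
    rewrite !inE !eqxx ij -val_eqE /= gtn_eqF //= !mulr1.
    by rewrite expr1 opprK.
  rewrite !inE; case: eqP => //= p1; case: eqP => //= p2.
  by case/eqP: pij; rewrite -p1 -p2 -surjective_pairing.
rewrite !inE; case: eqP => //= p1; case: eqP => //= p2.
by rewrite p1 p2 ltnNge ltnW.
Qed.

(* Matrices carry the sigma-algebra generated by their entries; over R this is
   the Borel sigma-algebra of 'M[R]_(m, k). *)
Definition mx_display : measure_display -> measure_display.
Proof. exact. Qed.

Section matrix_measurable.
Context {d} {T : sigmaRingType d}.
Variables m k : nat.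

Definition mx_sigma_generator : set (set 'M[T]_(m, k)) :=
  [set (fun M : 'M[T]_(m, k) => M ij.1 ij.2) @^-1` B
    | ij in [set: 'I_m * 'I_k] & B in measurable].

Definition mx_sigma : set (set 'M[T]_(m, k)) := <<s mx_sigma_generator >>.

Let mx_sigma0 : mx_sigma set0.
Proof. exact: sigma_algebra0. Qed.

Let mx_sigmaC A : mx_sigma A -> mx_sigma (~` A).
Proof. exact: sigma_algebraC. Qed.

Let mx_sigma_bigcup (F : (set 'M[T]_(m, k))^nat) :
  (forall i, mx_sigma (F i)) -> mx_sigma (\bigcup_i F i).
Proof. exact: sigma_algebra_bigcup. Qed.

HB.instance Definition _ := @isMeasurable.Build (mx_display d)
  'M[T]_(m, k) mx_sigma mx_sigma0 mx_sigmaC mx_sigma_bigcup.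

End matrix_measurable.

Lemma measurable_mx_entry d (T : sigmaRingType d) m k (i : 'I_m) (j : 'I_k) :
  measurable_fun [set: 'M[T]_(m, k)] (fun M : 'M[T]_(m, k) => M i j).
Proof.
move=> _ Y mY; rewrite setTI; apply: sub_sigma_algebra.
by exists (i, j) => //; exists Y.
Qed.

Lemma measurable_fun_mx d (T : sigmaRingType d) d' (T' : measurableType d')
    m k (f : T' -> 'M[T]_(m, k)) :
  (forall i j, measurable_fun [set: T'] (fun x => f x i j)) ->
  measurable_fun [set: T'] f.
Proof.
move=> mf; apply: (@measurability _ _ _ _ _ _ (@mx_sigma_generator _ T m k)) => //.
move=> _ [_ [[i j] _ [B mB <-]] <-].
exact: mf.
Qed.

Section cons_cV.
Variables (R : realType) (n : nat).

Definition cons_cV (p : R * 'cV[R]_n) : 'cV[R]_n.+1 := col_mx p.1%:M p.2.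

Definition uncons_cV (v : 'cV[R]_n.+1) : R * 'cV[R]_n :=
  (v ord0 ord0, dsubmx (v : 'cV[R]_(1 + n))).

Lemma cons_cVK : cancel cons_cV uncons_cV.
Proof.
move=> [t v]; rewrite /uncons_cV /cons_cV /= col_mxKd; congr pair.
have -> : ord0 = lshift n (ord0 : 'I_1) :> 'I_(1 + n) by exact: val_inj.
by rewrite (col_mxEu t%:M v) mxE.
Qed.

Lemma measurable_cons_cV : measurable_fun setT cons_cV.
Proof.
apply: measurable_fun_mx => i j; rewrite /cons_cV.
rewrite -(splitK (i : 'I_(1 + n))); case: (fintype.split _) => k /=.
  apply: (eq_measurable_fun fst) => // p _.
  by rewrite (col_mxEu p.1%:M p.2) !ord1 mxE.
apply: (eq_measurable_fun ((fun v : 'cV[R]_n => v k j) \o snd)) => [p _|].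
  by rewrite (col_mxEd p.1%:M p.2).
by apply: measurableT_comp; [exact: measurable_mx_entry|].
Qed.

HB.instance Definition _ := isMeasurableFun.Build _ _ _ _ cons_cV
  measurable_cons_cV.

Lemma measurable_uncons_cV : measurable_fun setT uncons_cV.
Proof.
apply/measurable_fun_pairP; split; first exact: measurable_mx_entry.
apply: measurable_fun_mx => i j; rewrite /uncons_cV /=.
under eq_fun do rewrite mxE.
exact: measurable_mx_entry.
Qed.

Variable mu : {sigma_finite_measure set 'cV[R]_n -> \bar R}.

Definition cV_measureS : set 'cV[R]_n.+1 -> \bar R :=
  pushforward (@lebesgue_measure R \x mu)%E cons_cV.

Let cV_measureS0 : cV_measureS set0 = 0%E.
Proof. by apply: measure0; exact: measurable_cons_cV. Qed.

Let cV_measureS_ge0 A : (0 <= cV_measureS A)%E.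
Proof. by apply: measure_ge0; exact: measurable_cons_cV. Qed.

Let cV_measureS_sigma_additive : semi_sigma_additive cV_measureS.
Proof.
apply: (@measure_semi_sigma_additive _ _ _
  (pushforward (@lebesgue_measure R \x mu)%E cons_cV)).
exact: measurable_cons_cV.
Qed.

HB.instance Definition _ := isMeasure.Build _ _ _ cV_measureS
  cV_measureS0 cV_measureS_ge0 cV_measureS_sigma_additive.

Let cV_measureS_sigma_finite : sigma_finite setT cV_measureS.
Proof.
have /sigma_finiteP[F [TF ndF Foo]] := sigma_finiteT (@lebesgue_measure R).
have /sigma_finiteP[G [TG ndG Goo]] := sigma_finiteT mu.
exists (fun k => uncons_cV @^-1` (F k `*` G k)).
  rewrite -preimage_bigcup; apply/esym/seteqP; split => // v _ /=.
  have [/= i _ Fi] : (\bigcup_i F i) (uncons_cV v).1 by rewrite -TF.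
  have [/= j _ Gj] : (\bigcup_j G j) (uncons_cV v).2 by rewrite -TG.
  exists (maxn i j) => //; split.
  - by move: Fi; exact/subsetPset/ndF/leq_maxl.
  - by move: Gj; exact/subsetPset/ndG/leq_maxr.
move=> k; have [mF Fk] := Foo k; have [mG Gk] := Goo k; split.
  rewrite -[X in measurable X]setTI; apply: measurable_uncons_cV => //.
  exact: measurableX.
rewrite /cV_measureS /pushforward -comp_preimage.
rewrite (_ : uncons_cV \o cons_cV = id); last exact/funext/cons_cVK.
by rewrite preimage_id product_measure1E// lte_mul_pinfty// ge0_fin_numE.
Qed.

HB.instance Definition _ := Measure_isSigmaFinite.Build _ _ _ cV_measureS
  cV_measureS_sigma_finite.

End cons_cV.

Fixpoint lebesgue_cV (R : realType) (n : nat) :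
    {sigma_finite_measure set 'cV[R]_n -> \bar R} :=
  match n with
  | 0 => \d_(0 : 'cV[R]_0)
  | m.+1 => cV_measureS (lebesgue_cV R m)
  end.

Lemma lebesgue_cV_box (R : realType) (n : nat) (A : 'I_n -> set R) :
  (forall i, measurable (A i)) ->
  lebesgue_cV R n [set v | forall i, A i (v i ord0)] =
  (\prod_(i < n) lebesgue_measure (A i))%E.
Proof.
elim: n A => [|n IH] A mA.
  by rewrite big_ord0 /= diracE mem_set // => -[].
have mB : measurable [set v : 'cV[R]_n | forall i, A (lift ord0 i) (v i ord0)].
  rewrite (_ : [set v | _] = \bigcap_(i in [set: 'I_n])
      (fun v : 'cV[R]_n => v i ord0) @^-1` A (lift ord0 i)); last first.
    by apply/seteqP; split => v /= vA i => [_|]; exact: vA.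
  apply: fin_bigcap_measurable => // i _.
  by rewrite -[X in measurable X]setTI; exact: measurable_mx_entry.
rewrite big_ord_recl -IH // -product_measure1E //; last exact: mA.
rewrite /= /cV_measureS /pushforward.
congr (_ _); apply/seteqP; split => -[t v] /=; rewrite /cons_cV /= => H.
  split=> [|i].
    have := H ord0; have -> : ord0 = lshift n (ord0 : 'I_1) :> 'I_(1 + n).
      exact: val_inj.
    by rewrite (col_mxEu t%:M v) mxE eqxx.
  have := H (lift ord0 i); rewrite -rshift1.
  by rewrite (col_mxEd t%:M v).
case: H => tA vA i; rewrite -(splitK (i : 'I_(1 + n))).
case: (fintype.split _) => k /=.
  rewrite (col_mxEu t%:M v) !ord1 mxE eqxx mulr1n.
  by rewrite (_ : lshift n ord0 = ord0) //; exact: val_inj.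
by rewrite (col_mxEd t%:M v) rshift1.
Qed.

Section Wavelet.
Variables (R : realType) (n : nat).
Local Notation Rn := 'cV[R]_n.
Local Notation leb := (lebesgue_cV R n).
Implicit Types (f psi g : Rn -> Cl R n) (x w b : Rn) (r : 'M[R]_n).

(* Measurability with respect to the Lebesgue (completed Borel) sigma-algebra:
   equality almost everywhere with a Borel function. *)
Definition cl_measurable f :=
  exists2 g : Rn -> Cl R n,
    (forall A : {set 'I_n}, measurable_fun [set: Rn] (fun x => g x A))
    & {ae leb, forall x, f x = g x}.

Definition L1 f :=
  cl_measurable f /\ (\int[leb]_x (cl_norm (f x))%:E < +oo)%E.

Definition L2 f :=
  cl_measurable f /\ (\int[leb]_x (cl_norm (f x) ^+ 2)%:E < +oo)%E.

Definition cl_integral f : Cl R n :=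
  [ffun A : {set 'I_n} => \int[leb]_x (f x A)].

Definition dot w x : R := \sum_(i < n) w i ord0 * x i ord0.

(* The integral formula for the Clifford Fourier transform, meaningful for
   f in L^1. *)
Definition CFT f w : Cl R n :=
  cl_integral (fun x => f x * cl_exp (- (dot w x *: pseudoscalar R n))).

Definition L2_sqdist f g : \bar R :=
  (\int[leb]_x (cl_norm (f x - g x) ^+ 2)%:E)%E.

(* g is (a representative of) the Fourier transform of f in L^2: the extension
   of CFT from the dense subspace L^1 /\ L^2 by L^2-continuity. *)
Definition is_CFT f g :=
  L2 f /\ L2 g /\
  exists u : nat -> Rn -> Cl R n,
    (forall k, L1 (u k) /\ L2 (u k)) /\
    L2_sqdist (u k) f @[k --> \oo] --> 0%E /\
    L2_sqdist (CFT (u k)) g @[k --> \oo] --> 0%E.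

Definition SO : set 'M[R]_n := [set r | r *m r^T = 1%:M /\ \det r = 1].

(* The normalized Haar measure of SO(n), as a Borel measure on n x n matrices
   carried by SO(n). *)
Definition is_haar_SO (haar : {measure set 'M[R]_n -> \bar R}) :=
  haar SO = 1%E /\ haar (~` SO) = 0%E /\
  forall r, SO r -> forall B : set 'M[R]_n, measurable B ->
    haar ((fun s => r *m s) @^-1` B) = haar B.

Definition daughter psi (a : R) r b x : Cl R n :=
  a `^ (- (n%:R / 2)) *: psi (invmx r *m (a^-1 *: (x - b))).

(* The coefficients of C_psi at the frequency w, as extended reals. The
   integral is finite iff all coefficients are: the scalar coefficient is the
   integral of |psihat|^2, which bounds the integrands of all the others. *)
Definition admissibility_integral (haar : {measure set 'M[R]_n -> \bar R})
    (psihat : Rn -> Cl R n) w (A : {set 'I_n}) : \bar R :=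
  (\int[lebesgue_measure]_(a in `]0%R, +oo[) \int[haar]_(r in SO)
    ((a ^+ n *: (reverse (psihat (a *: (invmx r *m w)))
                 * psihat (a *: (invmx r *m w)))) A * a ^- n.+1)%:E)%E.

Definition admissible (haar : {measure set 'M[R]_n -> \bar R}) psi :=
  L2 psi /\
  (exists2 psihat, is_CFT psi psihat &
    exists2 C : Cl R n, cl_invertible C &
      {ae leb, forall w, forall A : {set 'I_n},
        admissibility_integral haar psihat w A = (C A)%:E}) /\
  ((n %% 4)%N = 2%N ->
    {ae leb, forall x, even_grade (psi x)} \/
    {ae leb, forall x, odd_grade (psi x)}).

Definition wavelet_transform psi f (a : R) r b : Cl R n :=
  cl_integral (fun x => f x * reverse (daughter psi a r b x)).

End Wavelet.

(* Main.v *)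
Require Import Defs.
From HB Require Import structures.
From mathcomp Require Import all_boot all_order all_algebra.
From mathcomp Require Import all_classical all_reals all_analysis.
From mathcomp Require Import measurable_realfun.

Set Implicit Arguments.
Unset Strict Implicit.
Unset Printing Implicit Defensive.

Import Order.TTheory GRing.Theory Num.Theory.
Import numFieldNormedType.Exports.

Local Open Scope classical_set_scope.
Local Open Scope ring_scope.

(* Substituting x + x0 for x turns one transform into the other. The integrand
   of the transform is only almost everywhere equal to a Borel function, so the
   change of variables is proved for arbitrary functions: a bijection which is
   measure preserving in both directions carries the simple functions below f
   to the simple functions below its transport. *)

Section measure_preserving_bijection.
Local Open Scope ereal_scope.
Context d1 d2 (X : measurableType d1) (Y : measurableType d2) (R : realType).
Variables (mu : {measure set X -> \bar R}) (nu : {measure set Y -> \bar R}).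
Variable phi : X -> Y.
Hypothesis mphi : measurable_fun [set: X] phi.
Hypothesis phi_preserving :
  forall B, measurable B -> mu (phi @^-1` B) = nu B.

Import HBNNSimple.

(** Only one inequality arises this way: each simple [h] below [f] yields [h \o phi] below
    [f \o phi], but a simple function below [f \o phi] need not factor through [phi]. *)
Lemma le_ge0_integral_comp_preserving (f : Y -> \bar R) :
  (forall y, 0 <= f y) -> \int[nu]_y f y <= \int[mu]_x f (phi x).
Proof.
move=> f0; rewrite !ge0_integralTE//.
apply: ge_ereal_sup => _ [h /= hf <-].
have mh : measurable_fun [set: X] (h \o phi) by exact: measurableT_comp.
have fh : finite_set (range (h \o phi)).
  by apply: (sub_finite_set _ (fimfunP h)) => _ [x _ <-] /=; exists (phi x).
have h0 x : (0 <= (h \o phi) x)%R by exact: fun_ge0.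
pose hphi := HB.pack_for {nnsfun X >-> R} (h \o phi)
  (isMeasurableFun.Build _ _ _ _ _ mh) (FiniteImage.Build _ _ _ fh)
  (isNonNegFun.Build _ _ _ h0).
apply: ereal_sup_ubound; exists hphi => /= [x|]; first exact: hf.
(* The level sets of [h \o phi] are the preimages under [phi] of those of [h], hence have the same
   measure. *)
rewrite /sintegral; apply: eq_fsbigr => t _; congr (_ * _).
by rewrite -[RHS]phi_preserving.
Qed.

End measure_preserving_bijection.

Section integral_comp_preserving.
Local Open Scope ereal_scope.
Context d1 d2 (X : measurableType d1) (Y : measurableType d2) (R : realType).
Variables (mu : {measure set X -> \bar R}) (nu : {measure set Y -> \bar R}).
Variables (phi : X -> Y) (phi' : Y -> X).
Hypotheses (mphi : measurable_fun [set: X] phi)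
  (mphi' : measurable_fun [set: Y] phi').
Hypothesis phi'K : cancel phi' phi.
Hypothesis phiK : cancel phi phi'.
Hypothesis phi_preserving :
  forall B, measurable B -> mu (phi @^-1` B) = nu B.

Lemma ge0_integral_comp_preserving (f : Y -> \bar R) :
  (forall y, 0 <= f y) -> \int[mu]_x f (phi x) = \int[nu]_y f y.
Proof.
move=> f0; apply/eqP; rewrite eq_le; apply/andP; split; last first.
  exact: le_ge0_integral_comp_preserving.
(* The reverse inequality is the same lemma along [phi'], applied to [f \o phi]. *)
rewrite -[X in _ <= integral _ _ X](_ : (f \o phi) \o phi' = f); last first.
  by apply/funext => y /=; rewrite phi'K.
apply: (le_ge0_integral_comp_preserving mphi' _ (f := f \o phi)) => [A mA|x].
  (* [phi'] inherits preservation: pulling the preimage of [A] under [phi'] back along [phi] returns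
     [A]. *)
  rewrite -phi_preserving; last by rewrite -[X in measurable X]setTI; exact: mphi'.
  by congr (mu _); apply/seteqP; split => x /=; rewrite phiK.
exact: f0.
Qed.

Lemma integral_comp_preserving (f : Y -> \bar R) :
  \int[mu]_x f (phi x) = \int[nu]_y f y.
Proof.
(* Positive and negative parts are compared separately, so the two differences agree even in the
   case of infinity minus infinity. *)
rewrite integralE [RHS]integralE; congr (_ - _).
  rewrite -(ge0_integral_comp_preserving (f := f^\+)) //.
  by apply: eq_integral => x _; rewrite !funeposE.
rewrite -(ge0_integral_comp_preserving (f := f^\-)) //.
by apply: eq_integral => x _; rewrite !funenegE.
Qed.

End integral_comp_preserving.

Section translation.
Variable R : realType.

(** The pushforward under the translation gives the half-open intervals their lengths, and this
    determines Lebesgue measure. *)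
Lemma lebesgue_measure_translation (t : R) (A : set R) : measurable A ->
  lebesgue_measure ((fun x : R => x + t) @^-1` A) = lebesgue_measure A.
Proof.
pose mu := pushforward (@lebesgue_measure R)
  ((fun x => x + t) : _ -> measurableTypeR R).
move=> mA; apply/esym; rewrite -[RHS]/(mu A).
apply: lebesgue_measure_unique => //=; first exact: measurable_funD.
move=> _ _ [[u v]] _ <-; rewrite /pushforward.
rewrite (_ : _ @^-1` _ = [set` `]u - t, v - t]]); last first.
  by apply/seteqP; split => x /=; rewrite !in_itv /= ltrBlDr lerBrDr.
rewrite !lebesgue_measure_itv /= !lte_fin ltrD2r -!EFinD.
by rewrite (_ : v - t - (u - t) = v - u) // opprB addrA subrK.
Qed.

Lemma measurable_cV_translation n (v0 : 'cV[R]_n) :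
  measurable_fun [set: 'cV[R]_n] (fun v => v + v0).
Proof.
apply: measurable_fun_mx => i j.
under eq_fun do rewrite mxE.
by apply: measurable_funD => //; exact: measurable_mx_entry.
Qed.

Lemma uncons_cVK n : cancel (@uncons_cV R n) (@cons_cV R n).
Proof.
move=> v; rewrite /cons_cV /uncons_cV /=.
rewrite (_ : (v ord0 ord0)%:M = usubmx (v : 'cV_(1 + n))).
  exact: (@vsubmxK _ 1 n 1 v).
apply/matrixP => i j; rewrite !ord1 !mxE eqxx mulr1n.
by congr (v _ _); exact: val_inj.
Qed.

Lemma cons_cVD n : {morph @cons_cV R n : p q / p + q}.
Proof. by move=> p q; rewrite /cons_cV /= raddfD /= -add_col_mx. Qed.

(** Induction on the dimension: the measure is the integral, over the first coordinate, of the
    measures of the sections. *)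
Lemma lebesgue_cV_translation n (v0 : 'cV[R]_n) (A : set 'cV[R]_n) :
  measurable A -> lebesgue_cV R n ((fun v => v + v0) @^-1` A) = lebesgue_cV R n A.
Proof.
elim: n v0 A => [|n IH] v0 A mA.
  congr (lebesgue_cV R 0 _); apply/seteqP.
  by split => v /=; rewrite (flatmx0 (v + v0)) (flatmx0 v).
rewrite -(uncons_cVK v0); move: (uncons_cV v0) => [t w] {v0}.
pose B := @cons_cV R n @^-1` A.
have mB : measurable B.
  by rewrite -[X in measurable X]setTI; exact: measurable_cons_cV.
rewrite /= /cV_measureS /pushforward /product_measure1 -/B.
(* The induction hypothesis absorbs [w] inside each section; the shift [t] of the base point remains
   for the one-dimensional case. *)
transitivity (\int[lebesgue_measure]_x
    lebesgue_cV R n (xsection B (x + t)%R))%E.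
  apply: eq_integral => x _ /=.
  rewrite -[RHS](IH w); last exact: measurable_xsection.
  congr (lebesgue_cV R n _); rewrite !xsectionE.
  by apply/seteqP; split => v /=; rewrite /B /= -cons_cVD.
apply: (@integral_comp_preserving _ _ _ _ _ (@lebesgue_measure R)
  (@lebesgue_measure R) (fun x : measurableTypeR R => x + t)
  (fun x : measurableTypeR R => x - t) _ _ _ _ _
  (fun x => lebesgue_cV R n (xsection B x))).
- exact: measurable_funD.
- exact: measurable_funB.
- exact: subrK.
- exact: addrK.
- exact: lebesgue_measure_translation.
Qed.

Lemma Rintegral_lebesgue_cV_translation n (v0 : 'cV[R]_n) (f : 'cV[R]_n -> R) :
  \int[lebesgue_cV R n]_x f (x + v0) = \int[lebesgue_cV R n]_x f x.
Proof.
(* The real integral is [fine] of the extended one, so an infinite value becomes 0 on both sides. *)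
congr fine; apply: (@integral_comp_preserving _ _ _ _ _ (lebesgue_cV R n)
  (lebesgue_cV R n) (fun v => v + v0) (fun v => v - v0) _ _ _ _ _ (EFin \o f)).
- exact: measurable_cV_translation.
- exact: measurable_cV_translation.
- exact: subrK.
- exact: addrK.
- exact: lebesgue_cV_translation.
Qed.

Lemma cl_integral_translation n (v0 : 'cV[R]_n) (g : 'cV[R]_n -> Cl R n) :
  cl_integral (fun x => g (x + v0)) = cl_integral g.
Proof.
apply/ffunP => A; rewrite /cl_integral !ffunE.
exact: (Rintegral_lebesgue_cV_translation v0 (fun x => g x A)).
Qed.

End translation.

Theorem mainTheorem6 (R : realType) (n : nat)
    (hn : (n %% 4)%N = 2%N \/ (n %% 4)%N = 3%N)
    (haar : {measure set 'M[R]_n -> \bar R}) (hhaar : is_haar_SO haar)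
    (psi : 'cV[R]_n -> Cl R n) (hpsi : admissible haar psi)
    (f : 'cV[R]_n -> Cl R n) (hf : L2 f) (x0 : 'cV[R]_n)
    (a : R) (ha : 0 < a) (r : 'M[R]_n) (hr : SO r) (b : 'cV[R]_n) :
  wavelet_transform psi (fun x => f (x - x0)) a r b =
  wavelet_transform psi f a r (b - x0).
Proof.
rewrite /wavelet_transform -[RHS](cl_integral_translation (- x0)).
congr (cl_integral _); apply/funext => x.
(* The shifts cancel before rotation and dilation act: [x - x0 - (b - x0) = x - b]. *)
by rewrite /daughter opprB addrA subrK.
Qed.
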